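(* Let $0<\alpha<1$ and let $d_\alpha$ be the metric on $[0,\infty)$ given by $d_\alpha(x,y)=\left((x-y)^2+(x^\alpha-y^\alpha)^2\right)^{1/2}$. Then $C([0,\infty),d_\alpha)=1$.
   Context: For a metric space $(X,d)$ and $\mu,\delta \geq 0$, say that $(X,d)$ satisfies the $(\mu,\delta)$-four-point inequality if for all $x,y,z,w\in X$, $d(x,y)+d(z,w)\le \mu\max\{d(x,z)+d(y,w),\ d(x,w)+d(y,z)\}+2\delta$. The quasi-hyperbolicity constant of $(X,d)$ is $C(X,d)=\inf\{\mu\geq 0\mid \text{there exists }\delta\geq 0\text{ such that }(X,d)\text{ satisfies the }(\mu,\delta)\text{-four-point inequality}\}$. *)

(* Defs.v *)
From HB Require Import structures.
From mathcomp Require Import all_boot all_order all_algebra.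
From mathcomp Require Import all_classical all_reals all_analysis.
From mathcomp Require Import ring lra.

Set Implicit Arguments.
Unset Strict Implicit.
Unset Printing Implicit Defensive.

Import Order.TTheory GRing.Theory Num.Theory.

Local Open Scope classical_set_scope.
Local Open Scope ring_scope.

Definition four_point_inequality (R : realType) (X : metricType R)
    (mu delta : R) : Prop :=
  forall x y z w : X,
    mdist x y + mdist z w <=
      mu * Num.max (mdist x z + mdist y w) (mdist x w + mdist y z) + 2 * delta.

Definition four_point_factors (R : realType) (X : metricType R) : set R :=
  [set mu | 0 <= mu /\
            exists delta : R, 0 <= delta /\ four_point_inequality X mu delta].

Definition quasi_hyperbolicity_constant (R : realType) (X : metricType R) : R :=
  inf (four_point_factors X).

(* [inf] is total, with value 0 on sets without an infimum; this never happens
   here, as every metric space satisfies the (2, 0)-four-point inequality. *)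
Lemma four_point_factors_has_inf (R : realType) (X : metricType R) :
  has_inf (four_point_factors X).
Proof.
split; last by exists 0 => mu [].
exists 2; split; first by [].
exists 0; split=> // x y z w.
have := metric_triangle x z y; have := metric_triangle x w y.
have := metric_triangle z x w; have := metric_triangle z y w.
rewrite (metric_sym z x) (metric_sym z y) (metric_sym w y).
have : mdist x z + mdist y w <=
    Num.max (mdist x z + mdist y w) (mdist x w + mdist y z).
  by rewrite le_max lexx.
have : mdist x w + mdist y z <=
    Num.max (mdist x z + mdist y w) (mdist x w + mdist y z).
  by rewrite le_max lexx orbT.
lra.
Qed.

(* The half-line [0, +oo[; the parameter [alpha] is a phantom that selects the
   metric [power_dist] in the canonical instance below. *)
Definition power_halfline (R : realType) (alpha : R) : Type :=
  {x : R | 0 <= x}.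

HB.instance Definition _ (R : realType) (alpha : R) :=
  Choice.copy (power_halfline alpha) {x : R | 0 <= x}.

Definition power_dist (R : realType) (alpha : R)
    (x y : power_halfline alpha) : R :=
  Num.sqrt ((sval x - sval y) ^+ 2
            + (sval x `^ alpha - sval y `^ alpha) ^+ 2).

Section power_dist_metric.
Variables (R : realType) (alpha : R).
Implicit Types x y z : power_halfline alpha.

Let power_distxx x : power_dist x x = 0.
Proof. by rewrite /power_dist !subrr expr0n addr0 sqrtr0. Qed.

Let power_dist_eq0 x y : power_dist x y = 0 -> x = y.
Proof.
move=> /eqP; rewrite /power_dist sqrtr_eq0 => h.
apply: val_inj => /=; apply/eqP; rewrite -subr_eq0 -sqrf_eq0 eq_le sqr_ge0 andbT.
by apply: le_trans h; rewrite lerDl sqr_ge0.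
Qed.

Let power_dist_sym x y : power_dist x y = power_dist y x.
Proof.
by rewrite /power_dist -sqrrN opprB -(sqrrN (_ `^ _ - _)) opprB.
Qed.

Let minkowski2 (a b c d : R) :
  Num.sqrt ((a + c) ^+ 2 + (b + d) ^+ 2) <=
  Num.sqrt (a ^+ 2 + b ^+ 2) + Num.sqrt (c ^+ 2 + d ^+ 2).
Proof.
have S0 (u v : R) : 0 <= u ^+ 2 + v ^+ 2 by rewrite addr_ge0 ?sqr_ge0.
rewrite -(@ler_pXn2r _ 2) ?nnegrE ?addr_ge0 ?sqrtr_ge0//.
rewrite [leRHS]sqrrD !sqr_sqrtr// -sqrtrM//.
suff : a * c + b * d <= Num.sqrt ((a ^+ 2 + b ^+ 2) * (c ^+ 2 + d ^+ 2)) by lra.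
apply: le_trans (ler_norm _) _; rewrite -sqrtr_sqr ler_wsqrtr//.
by have := sqr_ge0 (a * d - b * c); lra.
Qed.

Let power_dist_triangle y x z :
  power_dist x z <= power_dist x y + power_dist y z.
Proof.
by apply: le_trans (minkowski2 _ _ _ _); rewrite /power_dist !addrA !subrK.
Qed.

HB.instance Definition _ := isMetric.Build R (power_halfline alpha)
  power_distxx power_dist_eq0 power_dist_sym power_dist_triangle.

End power_dist_metric.

Lemma mdist_power_halfline (R : realType) (alpha : R)
    (x y : power_halfline alpha) :
  mdist x y = Num.sqrt ((sval x - sval y) ^+ 2
                        + (sval x `^ alpha - sval y `^ alpha) ^+ 2).
Proof. by []. Qed.

(* Main.v *)
Require Import Defs.
From mathcomp Require Import all_boot all_order all_algebra.
From mathcomp Require Import all_classical all_reals all_analysis.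
From mathcomp Require Import lra.
Import Order.TTheory GRing.Theory Num.Theory.
Local Open Scope ring_scope.

(** The first coordinate compares the half-line with the real line, which
    satisfies the [(1, 0)]-four-point inequality: clearly
    [|x - y| <= d x y <= |x - y| + |x `^ alpha - y `^ alpha|], and since
    [alpha < 1] the last term is sublinear in [|x - y|], that is, for every
    [eps > 0] it is at most [eps * |x - y| + C] for some [C].  So [d] lies
    between [|x - y|] and [(1 + eps) * |x - y| + C]; bounding the left-hand side
    of the four-point inequality from above and its right-hand side from below
    gives the inequality with factor [1 + eps] and additive constant [2 * C]
    ([four_point_inequality_line_approx]).  The constant is therefore at most 1.
    It is at least 1 because the space is unbounded: evaluating the inequality
    on two coinciding pairs of far apart points excludes every smaller factor
    ([four_point_factor_ge1]). *)

(** The sum on the left is one of [+-(a - b) +-(c - d)]; regrouping the terms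
    with equal signs writes each of these as a sum of differences on the right. *)
Lemma line_four_point {R : realDomainType} (a b c d : R) :
  `|a - b| + `|c - d| <=
  Num.max (`|a - c| + `|b - d|) (`|a - d| + `|b - c|).
Proof.
have := ler_norm (a - c); have := ler_norm (c - a); rewrite (distrC c a).
have := ler_norm (b - d); have := ler_norm (d - b); rewrite (distrC d b).
have := ler_norm (a - d); have := ler_norm (d - a); rewrite (distrC d a).
have := ler_norm (b - c); have := ler_norm (c - b); rewrite (distrC c b).
rewrite le_max; move=> *; apply/orP.
case: (ger0P (a - b)) => _; case: (ger0P (c - d)) => _;
  first [by left; lra | by right; lra].
Qed.

Lemma four_point_inequality_line_approx {R : realType} {X : metricType R}
    (f : X -> R) (mu delta : R) : 0 <= mu ->
    (forall x y, `|f x - f y| <= mdist x y) ->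
    (forall x y, mdist x y <= mu * `|f x - f y| + delta) ->
  four_point_inequality X mu delta.
Proof.
move=> mu0 lef fle x y z w.
apply: (@le_trans _ _ (mu * (`|f x - f y| + `|f z - f w|) + 2 * delta)).
  by have := fle x y; have := fle z w; lra.
rewrite lerD2r ler_wpM2l// (le_trans (line_four_point _ _ _ _))//.
by apply: le_max2; exact: lerD.
Qed.

(** For [x = z] and [y = w] the inequality reads
    [2 * d x y <= mu * (2 * d x y) + 2 * delta], so that [mu < 1] would bound
    all distances by [delta / (1 - mu)]. *)
Lemma four_point_factor_ge1 {R : realType} {X : metricType R} (mu : R) :
  (forall M : R, exists x y : X, M <= mdist x y) ->
  four_point_factors X mu -> 1 <= mu.
Proof.
move=> unbounded [mu0 [delta [delta0 fp]]].
rewrite leNgt; apply/negP => mu1.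
have [x [y leM]] := unbounded ((delta + 1) / (1 - mu)).
have := fp x y x y; rewrite !mdistxx addr0 (metric_sym y x).
move: leM; rewrite ler_pdivrMr ?subr_gt0// => leM.
rewrite max_r ?addr_ge0 ?mdist_ge0//.
by move: leM; lra.
Qed.

(** After normalising to [x + y = 1], both summands can only grow when raised
    to a power [a <= 1]. *)
Lemma powR_subadditive {R : realType} (a x y : R) : a <= 1 -> 0 <= x -> 0 <= y ->
  (x + y) `^ a <= x `^ a + y `^ a.
Proof.
move=> a1 x0 y0; have [s0|s_gt0] := leP (x + y) 0.
  have -> : y = 0 by lra.
  by rewrite addr0 lerDl powR_ge0.
have part (u : R) : 0 <= u -> u <= x + y ->
    (x + y) `^ a * (u / (x + y)) <= u `^ a.
  rewrite le_eqVlt => /predU1P[<- _|u0 us]; first by rewrite mul0r mulr0 powR_ge0.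
  rewrite -[in leRHS](divfK (lt0r_neq0 s_gt0) u) mulrC.
  rewrite powRM ?divr_ge0 ?(ltW u0) ?(ltW s_gt0)// ler_wpM2r ?powR_ge0//.
  by rewrite ger1_powR// divr_gt0//= ler_pdivrMr// mul1r.
have := part x x0; have := part y y0; rewrite lerDl lerDr => /(_ x0) py /(_ y0) px.
apply: le_trans (lerD px py).
by rewrite -mulrDr -mulrDl divff ?lt0r_neq0// mulr1.
Qed.

Lemma powR_sublinear {R : realType} (a eps : R) : 0 <= a < 1 -> 0 < eps ->
  exists2 C : R, 0 <= C & forall t, 0 <= t -> t `^ a <= eps * t + C.
Proof.
move=> /andP[a0 a1] eps0.
(* [T > 0] is where the line through the origin of slope [eps] meets [t `^ a];
   the power lies below the line beyond [T], and is at most [T `^ a] before. *)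
pose T := eps `^ (a - 1)^-1.
have T0 : 0 < T by rewrite powR_gt0.
have slopeT : T `^ a / T = eps.
  rewrite -[X in _ / X]powRr1 ?(ltW T0)// -powRB ?(lt0r_neq0 T0) ?implybT//.
  by rewrite -powRrM mulVf ?powRr1 ?(ltW eps0)// subr_eq0 lt_eqF.
exists (T `^ a) => [|t t0]; first exact: powR_ge0.
have [tT|/ltW Tt] := leP t T.
  apply: (@le_trans _ _ (T `^ a)); last by rewrite lerDr mulr_ge0// ltW.
  by rewrite ge0_ler_powR// nnegrE// ltW.
apply: (@le_trans _ _ (eps * t)); last by rewrite lerDl powR_ge0.
rewrite -slopeT mulrAC -mulrA -{1}(divfK (lt0r_neq0 T0) t) (mulrC _ T).
rewrite powRM ?divr_ge0 ?(ltW T0)// ler_wpM2l ?powR_ge0//.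
by rewrite ler1_powR ?(ltW a1)// ler_pdivlMr// mul1r.
Qed.

Lemma dist_powR_le {R : realType} (a x y : R) : 0 <= a <= 1 ->
  0 <= x -> 0 <= y -> `|x `^ a - y `^ a| <= `|x - y| `^ a.
Proof.
move=> /andP[a0 a1]; wlog yx : x y / y <= x.
  move=> H x0 y0; have [|/ltW] := leP y x => yx; first exact: H.
  by rewrite distrC (distrC x) H.
move=> x0 y0; have xy0 : 0 <= x - y by rewrite subr_ge0.
rewrite (ger0_norm xy0) ger0_norm ?subr_ge0 ?ge0_ler_powR//.
by rewrite lerBlDr -{1}(subrK y x) powR_subadditive.
Qed.

Lemma sqrt_sqrD_le {R : rcfType} (u v : R) :
  Num.sqrt (u ^+ 2 + v ^+ 2) <= `|u| + `|v|.
Proof.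
rewrite -[leRHS]ger0_norm ?addr_ge0// -[leRHS]sqrtr_sqr ler_wsqrtr//.
rewrite sqrrD !real_normK ?num_real// lerD2r lerDl.
by rewrite mulrn_wge0// mulr_ge0.
Qed.

Section PowerHalfline.
Context {R : realType} {alpha : R}.
Implicit Types x y : power_halfline alpha.

Lemma power_halfline_dist_ge x y : `|sval x - sval y| <= mdist x y.
Proof.
by rewrite mdist_power_halfline -sqrtr_sqr ler_wsqrtr// lerDl sqr_ge0.
Qed.

Lemma power_halfline_dist_le (eps : R) : 0 < alpha < 1 -> 0 < eps ->
  exists2 C : R, 0 <= C &
    forall x y, mdist x y <= (1 + eps) * `|sval x - sval y| + C.
Proof.
move=> /andP[a0 a1] eps0.
have [||C C0 leC] := @powR_sublinear _ alpha eps; rewrite ?(ltW a0)//.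
exists C => // x y; rewrite mdist_power_halfline.
apply: le_trans (sqrt_sqrD_le _ _) _.
rewrite mulrDl mul1r -addrA lerD2l (le_trans _ (leC _ _))//.
by rewrite dist_powR_le ?(ltW a0) ?(ltW a1) ?(proj2_sig x) ?(proj2_sig y).
Qed.

Lemma power_halfline_unbounded (M : R) : exists x y, M <= mdist x y.
Proof.
pose x : power_halfline alpha := exist _ `|M| (normr_ge0 M).
pose o : power_halfline alpha := exist _ 0 (lexx 0).
exists x, o; apply: le_trans (power_halfline_dist_ge _ _).
by rewrite /= subr0 normr_id ler_norm.
Qed.

End PowerHalfline.

Theorem proposition3p4 (R : realType) (alpha : R) (halpha : 0 < alpha < 1) :
  quasi_hyperbolicity_constant (power_halfline alpha) = 1.
Proof.
have [ne0 lb] := four_point_factors_has_inf (power_halfline alpha).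
apply/eqP; rewrite eq_le; apply/andP; split; last first.
  apply: lb_le_inf => // mu.
  by apply: four_point_factor_ge1; exact: power_halfline_unbounded.
apply/ler_addgt0Pr => eps eps0; apply: ge_inf => //.
have [C C0 leC] := @power_halfline_dist_le _ _ _ halpha eps0.
have mu0 : 0 <= 1 + eps by rewrite addr_ge0// ltW.
split=> //; exists C; split=> //.
apply: (@four_point_inequality_line_approx _ (power_halfline alpha)
  (fun x => sval x)) => //.
exact: power_halfline_dist_ge.
Qed.
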